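(* Let $n=2m+1$ be odd, with $m\ge 1$. Let $f(x)=\sum_{k=0}^d x^k a_k$ be a polynomial function of degree $d\ge 1$ with Clifford coefficients $a_k\in\mathbb{R}_n$. Then there exist two zonal $m$-harmonic polynomials $A$ and $B$ with pole $1$, of degrees $d$ and $d-1$ respectively, such that $$f(x)=A(x)-x^cB(x)\qquad\text{for every }x\in\mathbb{R}^{n+1}.$$
   Context: $\mathbb{R}_n$ is the real Clifford algebra of signature $(0,n)$ with generators $e_1,\dots,e_n$ ($e_i^2=-1$, $e_ie_j=-e_je_i$ for $i\neq j$). The paravector space $\{x_0+x_1e_1+\cdots+x_ne_n : x_i\in\mathbb{R}\}\subseteq\mathbb{R}_n$ is identified with $\mathbb{R}^{n+1}$. Clifford conjugation is the linear anti-involution $x\mapsto x^c$ of $\mathbb{R}_n$ with $e_i^c=-e_i$; on paravectors $x^c=x_0-x_1e_1-\cdots-x_ne_n$. For a paravector $x$, $\operatorname{Im}(x)=\frac{x-x^c}{2}$. Powers $x^k$ are taken in $\mathbb{R}_n$. The degree of $f$ is $d$, i.e. $a_d\ne0$. The spherical derivative of a function $f$ is $f'_s(x)=\frac12\operatorname{Im}(x)^{-1}\big(f(x)-f(x^c)\big)$ for $x\in\mathbb{R}^{n+1}\setminus\mathbb{R}$. For $k\ge0$, $\mathcal{P}^m_k:=(x^{k+1})'_s$ is the spherical derivative of the Clifford power $x^{k+1}$; it is (the restriction of) a homogeneous polynomial of degree $k$ in $x_0,\dots,x_n$ with real coefficients, and so is regarded as defined on all of $\mathbb{R}^{n+1}$.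 A zonal $m$-harmonic polynomial with pole $1$ is a polynomial in $x_0,\dots,x_n$ of the form $\sum_{k=0}^{N}\mathcal{P}^m_k(x)\,b_k$ with $b_k\in\mathbb{R}_n$. Its degree is its total degree in $x_0,\dots,x_n$. (Each such polynomial $p$ is $m$-harmonic, i.e. $(\Delta_{n+1})^m p=0$ where $\Delta_{n+1}=\sum_{i=0}^n\partial^2/\partial x_i^2$, and axially symmetric, i.e. $p\circ T=p$ for every orthogonal transformation $T$ of $\mathbb{R}^{n+1}$ that fixes the real points.) *)

(* Defs.v *)
From HB Require Import structures.
From mathcomp Require Import all_boot all_order all_algebra all_field.
From mathcomp Require Import boolp reals.
From mathcomp Require Import mpoly.
From mathcomp Require Import ring.

Set Implicit Arguments.
Unset Strict Implicit.
Unset Printing Implicit Defensive.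

Import GRing.Theory Num.Theory.
Local Open Scope ring_scope.

(* An element is the family of its coordinates on the basis blades            *)
(* e_A = e_{i1} ... e_{ik}, A = {i1 < ... < ik}. The generators are indexed   *)
(* by 'I_n, i.e., from 0 to n - 1.                                            *)
Definition clifford (R : fieldType) (n : nat) : Type := {ffun {set 'I_n} -> R}.

HB.instance Definition _ (R : fieldType) n :=
  Vector.copy (clifford R n) {ffun {set 'I_n} -> R^o}.

Section Sign.
Variable n : nat.
Implicit Types A B C : {set 'I_n}.

(* Sorting the word e_A e_B takes one transposition of distinct generators    *)
(* per pair j < i and one substitution e_i ^ 2 = -1 per pair j = i.           *)
Definition bsign A B : bool :=
  odd #|[set p : 'I_n * 'I_n | (p.1 \in A) && (p.2 \in B) && (p.2 <= p.1)%N]|.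

Definition symdiff A B : {set 'I_n} := (A :\: B) :|: (B :\: A).

Lemma in_symdiff i A B : (i \in symdiff A B) = (i \in A) (+) (i \in B).
Proof. by rewrite !inE; case: (i \in A); case: (i \in B). Qed.

Lemma symdiffA : associative symdiff.
Proof. by move=> A B C; apply/setP=> i; rewrite !in_symdiff addbA. Qed.

Lemma symdiffC : commutative symdiff.
Proof. by move=> A B; apply/setP=> i; rewrite !in_symdiff addbC. Qed.

Lemma symdiff0 A : symdiff A set0 = A.
Proof. by apply/setP=> i; rewrite in_symdiff in_set0 addbF. Qed.

Lemma symdiffK A B : symdiff (symdiff A B) B = A.
Proof. by apply/setP=> i; rewrite !in_symdiff -addbA addbb addbF. Qed.

Lemma odd_card_set (T : finType) (P : pred T) :
  odd #|[set p | P p]| = \big[addb/false]_p P p.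
Proof.
rewrite -sum1_card (eq_bigl P) => [|p]; last by rewrite inE.
rewrite (big_morph odd oddD (erefl : odd 0 = false)) /= big_mkcond.
by apply: eq_bigr => p _; case: (P p).
Qed.

Lemma bsignDl A B C : bsign (symdiff A B) C = bsign A C (+) bsign B C.
Proof.
rewrite /bsign !odd_card_set -big_split; apply: eq_bigr => p _ /=.
by rewrite in_symdiff; case: (_ \in A); case: (_ \in B); case: (_ \in C);
  case: (_ <= _)%N.
Qed.

Lemma bsignDr A B C : bsign A (symdiff B C) = bsign A B (+) bsign A C.
Proof.
rewrite /bsign !odd_card_set -big_split; apply: eq_bigr => p _ /=.
by rewrite in_symdiff; case: (_ \in A); case: (_ \in B); case: (_ \in C);
  case: (_ <= _)%N.
Qed.

Lemma bsign0l A : bsign set0 A = false.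
Proof. by rewrite /bsign odd_card_set big1 // => p _; rewrite in_set0. Qed.

Lemma bsign0r A : bsign A set0 = false.
Proof. by rewrite /bsign odd_card_set big1 // => p _; rewrite in_set0 andbF. Qed.

Lemma bsign11 (i j : 'I_n) : bsign [set i] [set j] = (j <= i)%N.
Proof.
rewrite /bsign odd_card_set (bigD1 (i, j)) //= !inE !eqxx /= big1 ?addbF //.
by move=> [k l]; rewrite !inE /= xpair_eqE => /negPf->.
Qed.

End Sign.

Section Algebra.
Variables (R : fieldType) (n : nat).
Implicit Types (A B C : {set 'I_n}) (x y z : clifford R n).

Definition cl_one : clifford R n := [ffun A => (A == set0)%:R].

(* e_A e_B = (-1)^(bsign A B) e_(A symdiff B); here C = A symdiff B.          *)
Definition cl_mul x y : clifford R n :=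
  [ffun C => \sum_A (-1) ^+ bsign A (symdiff A C) * x A * y (symdiff A C)].

Lemma symdiff_inj A : injective (symdiff A).
Proof.
by apply: (can_inj (g := symdiff A)) => B; rewrite symdiffC (symdiffC A) symdiffK.
Qed.

Lemma symdiffKl A B : symdiff A (symdiff A B) = B.
Proof. by rewrite symdiffC (symdiffC A) symdiffK. Qed.

Lemma reindex_symdiff A (F : {set 'I_n} -> R) :
  \sum_B F B = \sum_B F (symdiff A B).
Proof. exact: (reindex_inj (@symdiff_inj A)). Qed.

Lemma cl_mulA : associative cl_mul.
Proof.
move=> x y z; apply/ffunP=> D; rewrite !ffunE.
transitivity (\sum_A \sum_B (-1) ^+ bsign A (symdiff A D) *
  (-1) ^+ bsign B (symdiff B (symdiff A D)) * x A * y B *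
    z (symdiff B (symdiff A D))).
  apply: eq_bigr => A _; rewrite ffunE mulr_sumr; apply: eq_bigr => B _; ring.
transitivity (\sum_C \sum_A (-1) ^+ bsign C (symdiff C D) *
  (-1) ^+ bsign A (symdiff A C) * x A * y (symdiff A C) * z (symdiff C D));
  last first.
  apply: eq_bigr => C _; rewrite ffunE mulr_sumr mulr_suml.
  by apply: eq_bigr => A _; ring.
rewrite [RHS]exchange_big; apply: eq_bigr => A _ /=.
rewrite [RHS](reindex_symdiff A); apply: eq_bigr => B _; rewrite symdiffKl.
rewrite !bsignDl !bsignDr -!signr_addb symdiffA (symdiffC B A).
congr ((-1) ^+ nat_of_bool _ * _ * _ * _).
by case: (bsign A A); case: (bsign A B); case: (bsign A D);
  case: (bsign B A); case: (bsign B B); case: (bsign B D).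
Qed.

Lemma cl_mul1r : left_id cl_one cl_mul.
Proof.
move=> x; apply/ffunP=> C; rewrite ffunE (bigD1 set0) //= big1 => [|A /negPf nA].
  by rewrite ffunE eqxx bsign0l symdiffC symdiff0 !mul1r addr0.
by rewrite ffunE nA mulr0 mul0r.
Qed.

Lemma cl_mulr1 : right_id cl_one cl_mul.
Proof.
move=> x; apply/ffunP=> C; rewrite ffunE (bigD1 C) //= big1 => [|A nA].
  have -> : symdiff C C = set0 by rewrite -{2}[C]symdiff0 symdiffKl.
  by rewrite ffunE eqxx bsign0r mul1r mulr1 addr0.
rewrite ffunE; case: eqP => [e|_]; last by rewrite mulr0.
by move: nA; rewrite -[C](symdiffKl A) e symdiff0 eqxx.
Qed.

Lemma cl_mulDl : left_distributive cl_mul +%R.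
Proof.
move=> x y z; apply/ffunP=> C; rewrite !ffunE -big_split /=.
by apply: eq_bigr => A _; rewrite ffunE; ring.
Qed.

Lemma cl_mulDr : right_distributive cl_mul +%R.
Proof.
move=> x y z; apply/ffunP=> C; rewrite !ffunE -big_split /=.
by apply: eq_bigr => A _; rewrite ffunE; ring.
Qed.

Lemma cl_one_neq0 : cl_one != 0.
Proof.
by apply/eqP=> /ffunP/(_ set0); rewrite !ffunE eqxx => /eqP; rewrite oner_eq0.
Qed.

Lemma cl_scaleAl (a : R) x y : a *: cl_mul x y = cl_mul (a *: x) y.
Proof.
apply/ffunP=> C; rewrite !ffunE /GRing.scale /= mulr_sumr.
by apply: eq_bigr => A _; rewrite ffunE /GRing.scale /=; ring.
Qed.

Lemma cl_scaleAr (a : R) x y : a *: cl_mul x y = cl_mul x (a *: y).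
Proof.
apply/ffunP=> C; rewrite !ffunE /GRing.scale /= mulr_sumr.
by apply: eq_bigr => A _; rewrite ffunE /GRing.scale /=; ring.
Qed.

End Algebra.

HB.instance Definition _ (R : fieldType) n :=
  GRing.Zmodule_isNzRing.Build (clifford R n) (@cl_mulA R n) (@cl_mul1r R n)
    (@cl_mulr1 R n) (@cl_mulDl R n) (@cl_mulDr R n) (@cl_one_neq0 R n).
HB.instance Definition _ (R : fieldType) n :=
  GRing.Lmodule_isLalgebra.Build R (clifford R n) (@cl_scaleAl R n).
HB.instance Definition _ (R : fieldType) n :=
  GRing.Lalgebra_isAlgebra.Build R (clifford R n) (@cl_scaleAr R n).
(* The inverse x^-1 used below comes from this instance.                      *)
HB.instance Definition _ (R : fieldType) n :=
  Algebra_isFalgebra.Build R (clifford R n).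

Section Conjugation.
Variables (R : fieldType) (n : nat).
Implicit Types (A B C : {set 'I_n}) (x y : clifford R n).

Definition blade A : clifford R n := [ffun B => (B == A)%:R].
Definition gen (i : 'I_n) : clifford R n := blade [set i].

Lemma cl_mulE x y C :
  (x * y) C = \sum_A (-1) ^+ bsign A (symdiff A C) * x A * y (symdiff A C).
Proof. by rewrite [LHS]ffunE. Qed.

Lemma cl_scaleE (a : R) x C : (a *: x) C = a * x C.
Proof. by rewrite [LHS]ffunE. Qed.

Lemma bladeM A B :
  blade A * blade B = (-1) ^+ bsign A B *: blade (symdiff A B).
Proof.
apply/ffunP=> C; rewrite cl_mulE cl_scaleE (bigD1 A) //= big1 => [|D /negPf nD].
  rewrite !ffunE eqxx mulr1 addr0 -[C in RHS](symdiffKl A).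
  rewrite (inj_eq (@symdiff_inj _ A)).
  by case: eqP => [->|]; rewrite ?mulr0.
by rewrite !ffunE nD mulr0 mul0r.
Qed.

Lemma blade0 : blade set0 = 1.
Proof. by apply/ffunP=> A; rewrite !ffunE. Qed.

Lemma gen_sqr i : gen i * gen i = -1.
Proof.
rewrite bladeM bsign11 leqnn scaleN1r.
by rewrite -{2}[[set i]]symdiff0 symdiffKl blade0.
Qed.

Lemma gen_anticomm i j : i != j -> gen i * gen j = - (gen j * gen i).
Proof.
move=> nij; rewrite !bladeM !bsign11 (symdiffC [set j]) -scaleNr; congr (_ *: _).
by case: (ltngtP i j) => [||/ord_inj e]; rewrite ?opprK //; rewrite e eqxx in nij.
Qed.

(* e_A^c = e_A^-1 = e_A^3 = (-1)^(bsign A A) e_A for every blade.             *)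
Definition clconj x : clifford R n := [ffun A => (-1) ^+ bsign A A * x A].

Lemma clconj_is_linear : linear clconj.
Proof.
by move=> a x y; apply/ffunP=> A; rewrite !ffunE /GRing.scale /=; ring.
Qed.

HB.instance Definition _ :=
  GRing.isLinear.Build R (clifford R n) (clifford R n) _ clconj clconj_is_linear.

Lemma clconjK : involutive clconj.
Proof. by move=> x; apply/ffunP=> A; rewrite !ffunE signrMK. Qed.

Lemma clconjM x y : clconj (x * y) = clconj y * clconj x.
Proof.
apply/ffunP=> C; rewrite cl_mulE ffunE cl_mulE (reindex_symdiff C) mulr_sumr.
apply: eq_bigr => A _; rewrite !ffunE.
have -> : symdiff (symdiff C A) C = A by rewrite (symdiffC C) symdiffK.
rewrite (symdiffC A C) !bsignDl !bsignDr.
have sgn_mul (b b' : bool) : (-1) ^+ (b (+) b') = (-1) ^+ b * (-1) ^+ b' :> R.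
  exact: signr_addb.
rewrite !sgn_mul.
case: (bsign A A); case: (bsign C C); case: (bsign C A); case: (bsign A C);
  rewrite /= ?expr0 ?expr1; ring.
Qed.

Lemma clconj1 : clconj 1 = 1.
Proof.
rewrite -blade0; apply/ffunP=> A; rewrite !ffunE.
by case: eqP => [->|]; rewrite ?bsign0l ?mulr0 // mul1r.
Qed.

Lemma clconj_gen i : clconj (gen i) = - gen i.
Proof.
apply/ffunP=> A; rewrite !ffunE; case: eqP => [->|]; last by rewrite mulr0 oppr0.
by rewrite bsign11 leqnn mulN1r.
Qed.

Definition clIm x : clifford R n := 2^-1 *: (x - clconj x).

Definition para (v : 'rV[R]_n.+1) : clifford R n :=
  (v 0 0)%:A + \sum_(i < n) v 0 (lift ord0 i) *: gen i.

(* Only the values of f at x and x^c matter: functions on paravectors are     *)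
(* represented by functions on the whole algebra.                             *)
Definition sphder (f : clifford R n -> clifford R n) x : clifford R n :=
  2^-1 *: ((clIm x)^-1 * (f x - f (clconj x))).

End Conjugation.


Section Unique.

Lemma poly_vanish (R : numDomainType) (q : {poly R}) :
  (forall t, q.[t] = 0) -> q = 0.
Proof.
move=> q0; apply: contraTeq (leqnn (size q)) => nz; rewrite -ltnNge.
have := max_poly_roots (rs := mkseq (fun i => i%:R) (size q)) nz.
rewrite size_mkseq; apply.
  by apply/allP=> t _; rewrite rootE q0.
by rewrite mkseq_uniq // => i j /eqP; rewrite eqr_nat => /eqP.
Qed.

Lemma mpoly_vanish (R : numDomainType) k (p : {mpoly R[k]}) :
  (forall v, p.@[v] = 0) -> p = 0.
Proof.
elim: k p => [|k IHk] p p0.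
  have m0 (m : 'X_{1..0}) : m = 0%MM by apply/mnmP=> -[].
  have pE : p = (p@_0)%:MP.
    by apply/mpolyP=> m; rewrite (m0 m) mcoeffC eqxx mulr1.
  by move: (p0 (fun=> 0)); rewrite pE mevalC => ->; rewrite mpolyC0.
have widP (i : 'I_k) : unlift ord_max (widen_ord (leqnSn k) i) = Some i.
  have -> : widen_ord (leqnSn k) i = lift ord_max i.
    by apply/val_inj; rewrite /= /bump leqNgt ltn_ord.
  exact: liftK.
have muni0 : muni p = 0.
  apply/polyP=> j; rewrite coef0; apply: IHk => v.
  suff /(congr1 (fun q : {poly R} => q`_j)) :
    map_poly (meval v) (muni p) = 0 by rewrite coef_map coef0.
  apply: poly_vanish => t.
  rewrite -(p0 (fun i => oapp v t (unlift ord_max i))) mevalE muniE.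
  rewrite rmorph_sum horner_sum; apply: eq_bigr => m _ /=.
  rewrite map_polyZ hornerZ map_polyXn hornerXn /= mevalZ mevalX -mulrA.
  rewrite big_ord_recr /= unlift_none; congr (_ * (_ * _)).
  by apply: eq_bigr => i _; rewrite widP mnmE.
apply/mpolyP=> m; rewrite mcoeff0.
have [/memN_msupp_eq0//|] := boolP (m \notin msupp p); rewrite negbK => mp.
pose w (m' : 'X_{1..k.+1}) :=
  [multinom m' (widen_ord (leqnSn k) i) | i < k]%MM.
have w_inj (m1 m2 : 'X_{1..k.+1}) : m1 ord_max = m2 ord_max -> w m1 = w m2 -> m1 = m2.
  move=> e1 /mnmP e2; apply/mnmP=> i; case: (unliftP ord_max i) => [j|] -> //.
  have -> : lift ord_max j = widen_ord (leqnSn k) j.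
    by apply/val_inj; rewrite /= /bump leqNgt ltn_ord.
  by move: (e2 j); rewrite !mnmE.
have := congr1 (fun q : {poly {mpoly R[k]}} => (q`_(m ord_max))@_(w m)) muni0.
rewrite muniE coef_sum raddf_sum coef0 mcoeff0 /= (bigD1_seq m) //=.
rewrite coefZ coefXn eqxx mulr1 mcoeffZ mcoeffX eqxx mulr1 big1 ?addr0 //.
move=> m' nm; rewrite coefZ coefXn; case: eqP => [e|_]; last by rewrite mulr0 mcoeff0.
rewrite mulr1 mcoeffZ mcoeffX; case: eqP => [e'|_]; last by rewrite mulr0.
by rewrite (w_inj m' m) ?eqxx // in nm.
Qed.

End Unique.

Section Zonal.
Variables (R : realType) (n : nat).
Implicit Types (v : 'rV[R]_n.+1) (x : clifford R n).

(* 1%VS is the real line in the algebra.                                      *)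
Definition sphder_power_poly (k : nat) (p : {mpoly R[n.+1]}) : Prop :=
  forall v, para v \notin 1%VS ->
    (p.@[v 0])%:A = sphder (fun x => x ^+ k.+1) (para v).

Lemma clconj_para v :
  clconj (para v) = (v 0 0)%:A - \sum_(i < n) v 0 (lift ord0 i) *: gen R i.
Proof.
rewrite raddfD /= linearZ /= clconj1 linear_sum -sumrN /=; congr (_ + _).
by apply: eq_bigr => i _; rewrite linearZ /= clconj_gen scalerN.
Qed.

Let N2 : {mpoly R[n.+1]} := \sum_i 'X_i ^+ 2.
Let T : {mpoly R[n.+1]} := 'X_0 *+ 2.

Lemma gen_sum_sqr (a : 'I_n -> R) :
  (\sum_i a i *: gen R i) ^+ 2 = - (\sum_i a i ^+ 2)%:A.
Proof.
have two : 2 != 0 :> R by rewrite pnatr_eq0.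
apply: (scalerI two); rewrite !scaler_nat expr2 big_distrlr /=.
rewrite mulr2n {2}exchange_big -big_split /= scaler_suml -sumrN -sumrMnl.
apply: eq_bigr => i _; rewrite -big_split /= (bigD1 i) //= big1 => [|j nji].
  rewrite addr0 -scalerAl -scalerAr gen_sqr scalerA -expr2 scalerN.
  by rewrite -mulr2n.
rewrite -!scalerAl -!scalerAr gen_anticomm 1?eq_sym // !scalerA mulrC scalerN.
by rewrite addNr.
Qed.

Lemma paraT v : para v + clconj (para v) = (T.@[v 0])%:A.
Proof.
rewrite clconj_para addrACA subrr addr0 -scalerDl.
by rewrite /T raddfMn /= mevalXU mulr2n.
Qed.

Lemma paraN v : para v * clconj (para v) = (N2.@[v 0])%:A.
Proof.
rewrite clconj_para /para.
set y := \sum_i _; set a := v 0 0.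
have ya : y * a%:A = a%:A * y by rewrite -scalerAr -scalerAl mulr1 mul1r.
rewrite mulrBr !mulrDl ya [a%:A * y + _]addrC opprD addrACA subrr addr0.
rewrite -expr2 gen_sum_sqr opprK -scalerAl mul1r scalerA -scalerDl.
congr (_ *: _); rewrite /N2 raddf_sum big_ord_recl /=.
by rewrite rmorphXn /= mevalXU -expr2; congr (_ + _); apply: eq_bigr => i _;
  rewrite rmorphXn /= mevalXU.
Qed.

Fixpoint power_rec k : {mpoly R[n.+1]} * {mpoly R[n.+1]} :=
  if k is k'.+1 then (T * (power_rec k').1 - N2 * (power_rec k').2, (power_rec k').1) else (1, 0).

Lemma para_powerE v k x : x = para v \/ x = clconj (para v) ->
  x ^+ k.+1 = (power_rec k).1.@[v 0] *: x - ((N2 * (power_rec k).2).@[v 0])%:A.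
Proof.
move=> hx; have x2 : x * x = T.@[v 0] *: x - (N2.@[v 0])%:A.
  have comm : clconj (para v) * para v = para v * clconj (para v).
    have -> : clconj (para v) = (T.@[v 0])%:A - para v.
      by rewrite -paraT addrC addKr.
    by rewrite mulrBl mulrBr mulr_algl mulr_algr.
  rewrite -[T.@[_] *: x]mulr_algl -paraT -paraN.
  case: hx => ->; rewrite [X in _ = X - _]mulrDl; first by rewrite comm addrK.
  by rewrite [X in _ = X - _]addrC addrK.
elim: k => [|k IHk].
  by rewrite expr1 mulr0 meval0 meval1 scale1r scale0r subr0.
rewrite exprSr IHk mulrBl -scalerAl x2 mulr_algl /=.
rewrite mevalB !mevalM scalerBr !scalerA.
rewrite scalerBl -addrA [- _ - _]addrC addrA [RHS]addrAC.
by rewrite !(mulrC (power_rec k).1.@[_]) addrAC.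
Qed.

Lemma sphder_power_poly_exists k :
  exists2 p : {mpoly R[n.+1]}, p \is k.-homog & sphder_power_poly k p.
Proof.
have Th : T \is 1.-homog by rewrite rpredMn // dhomogX /= mdeg1.
have Nh : N2 \is 2.-homog.
  by apply: rpred_sum => i _; rewrite (dhomogMn 2 (d := 1)) // dhomogX /= mdeg1.
exists (power_rec k).1.
  suff [] : (power_rec k).1 \is k.-homog /\ N2 * (power_rec k).2 \is k.+1.-homog by [].
  elim: k => [|k [h1 h2]] /=; first by rewrite dhomog1 mulr0 rpred0.
  by split; [rewrite rpredB //; exact: (dhomogM Th) | exact: (dhomogM Nh)].
move=> v nv; rewrite /sphder (para_powerE k (or_introl erefl)).
rewrite (para_powerE k (or_intror erefl)) opprB addrA subrK -scalerBr.
have two : 2 != 0 :> R by rewrite pnatr_eq0.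
have -> : para v - clconj (para v) = 2 *: clIm (para v).
  by rewrite scalerA divff // scale1r.
have yU : clIm (para v) \is a GRing.unit; last first.
  move: (clIm _) yU => y yU.
  by rewrite -!scalerAr !scalerA mulrCA mulVf // mulr1 mulVr.
set y := clIm _.
have yE : y = \sum_(i < n) v 0 (lift ord0 i) *: gen R i.
  rewrite /y /clIm clconj_para /para opprB [X in X + _]addrC addrACA subrr.
  by rewrite addr0 -mulr2n -scaler_nat scalerA mulVf // scale1r.
have sy : y * y = - (\sum_(i < n) v 0 (lift ord0 i) ^+ 2)%:A.
  by rewrite -expr2 yE gen_sum_sqr.
set r := \sum_(i < n) _ in sy.
have r0 : r != 0.
  apply: contra nv => /eqP r0.
  rewrite /para big1 => [|i _]; first by rewrite addr0; apply/vlineP; exists (v 0 0).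
  have /(_ i isT)/eqP := psumr_eq0P (fun i _ => sqr_ge0 (v 0 (lift ord0 i))) r0.
  by rewrite sqrf_eq0 => /eqP ->; rewrite scale0r.
apply/unitrP; exists (- r^-1 *: y).
have sV : (- r^-1) *: (y * y) = 1.
  by rewrite sy scaleNr scalerN opprK scalerA mulVf // scale1r.
by rewrite -[X in X = _]scalerAl -[in X in _ /\ X]scalerAr.
Qed.

Lemma sphder_power_poly_unique k p q : (0 < n)%N ->
  sphder_power_poly k p -> sphder_power_poly k q -> p = q.
Proof.
move=> n_gt0 hp hq; apply/eqP; rewrite -subr_eq0.
pose i0 := Ordinal n_gt0.
suff /eqP : 'X_(lift ord0 i0) * (p - q) = 0.
  rewrite mulf_eq0 => /orP[|//].
  by rewrite -msupp_eq0 msuppX.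
apply: mpoly_vanish => w; rewrite mevalM mevalXU mevalB.
pose v : 'rV[R]_n.+1 := \row_i w i.
have vw r : r.@[v 0] = r.@[w].
  by apply: meval_eq => i; rewrite mxE.
have [->|w0] := eqVneq (w (lift ord0 i0)) 0; first by rewrite mul0r.
have nv : para v \notin 1%VS.
  apply/negP=> /vlineP[a] /ffunP/(_ [set i0]).
  have s0 : ([set i0] == set0) = false by apply/negbTE/set0Pn; exists i0; rewrite inE.
  have addE (x y : clifford R n) C : (x + y) C = x C + y C by rewrite [LHS]ffunE.
  have zeroE C : (0 : clifford R n) C = 0 by rewrite [LHS]ffunE.
  have sumE (F : 'I_n -> clifford R n) C : (\sum_i F i) C = \sum_i F i C.
    exact: (big_morph (fun x : clifford R n => x C) (fun x y => addE x y C)).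
  rewrite /para -!blade0 addE !cl_scaleE !ffunE s0 !mulr0 add0r sumE.
  rewrite (bigD1 i0) //= big1 => [|i ni].
    by rewrite cl_scaleE ffunE eqxx mulr1 addr0 !mxE; apply/eqP.
  by rewrite cl_scaleE ffunE (inj_eq set1_inj) eq_sym (negPf ni) mulr0.
by rewrite -!vw (fmorph_inj (in_alg (clifford R n))
  (etrans (hp v nv) (esym (hq v nv)))) subrr mulr0.
Qed.

Definition zonal_poly (k : nat) : {mpoly R[n.+1]} :=
  s2val (cid2 (sphder_power_poly_exists k)).

Lemma zonal_polyP k : sphder_power_poly k (zonal_poly k).
Proof. exact: s2valP' (cid2 (sphder_power_poly_exists k)). Qed.

Lemma zonal_poly_homog k : zonal_poly k \is k.-homog.
Proof. exact: s2valP (cid2 (sphder_power_poly_exists k)). Qed.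

(* The variables are central in {mpoly (clifford R n)[n.+1]}, and msize is    *)
(* one plus the total degree.                                                 *)
Definition zonal_mharmonic (A : {mpoly (clifford R n)[n.+1]}) : Prop :=
  exists (N : nat) (b : nat -> clifford R n),
    A = \sum_(k < N.+1)
          map_mpoly (in_alg (clifford R n)) (zonal_poly k) * (b k)%:MP.

Definition cl_eval (A : {mpoly (clifford R n)[n.+1]}) v : clifford R n :=
  A.@[fun i => (v 0 i)%:A].

End Zonal.

(* Main.v *)
(* Write x^c for the conjugate of x, T = x + x^c and N = x x^c. The spherical *)
(* derivatives P_k of the powers x^(k+1) satisfy P_(k+1) = T P_k - N P_(k-1)  *)
(* and x^(k+1) = P_k x - N P_(k-1), whence x^k = P_k - x^c P_(k-1). Summing   *)
(* against the coefficients gives A = sum_(k <= d) P_k a_k and                *)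
(* B = sum_(k < d) P_k a_(k+1). As P_k is homogeneous of degree k and         *)
(* P_k(1) = k + 1, the leading terms P_d a_d and P_(d-1) a_d are nonzero.     *)

Require Import Defs.
From mathcomp Require Import all_boot all_order all_algebra all_field.
From mathcomp Require Import boolp reals.
From mathcomp Require Import mpoly.

Set Implicit Arguments.
Unset Strict Implicit.
Unset Printing Implicit Defensive.

Import GRing.Theory Num.Theory.
Local Open Scope ring_scope.

(** [zonal_polyE] identifies P_k with the first component of [power_rec], so its recurrence and
    [para_powerE] yield x^(k+1) = P_(k+1) - x^c P_k at every paravector, real ones included
    ([para_exprS_zonal]). The degrees follow from [msize_zonal_sum]: the P_k are homogeneous of
    distinct degrees, so the summands P_k b_k cannot cancel, and their coefficients are real
    multiples of b_k, so zero divisors of the algebra do no harm. *)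

Section ScalarCoefficients.
Variables (R : realType) (n : nat).
Implicit Types (p : {mpoly R[n.+1]}) (b : clifford R n) (v : 'rV[R]_n.+1).

(** Real coefficients are central, so multiplying by the constant b only scales b; coefficients and
    values of P_k b_k thus reduce to real scalars. *)
Lemma map_mpoly_algMC p b :
  map_mpoly (in_alg (clifford R n)) p * b%:MP =
  \sum_(m <- msupp p) (p@_m *: b) *: 'X_[m].
Proof.
rewrite /map_mpoly /mmap mulr_suml; apply: eq_bigr => m _.
rewrite mmap1_id -mulrA -commr_mpolyX mulrA -mpolyCM mul_mpolyC.
by rewrite mulr_algl.
Qed.

Lemma mcoeff_map_mpoly_algMC p b m :
  (map_mpoly (in_alg (clifford R n)) p * b%:MP)@_m = p@_m *: b.
Proof.
rewrite map_mpoly_algMC raddf_sum [in RHS](mpolyE p) raddf_sum scaler_suml /=.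
apply: eq_bigr => k _; rewrite !mcoeffZ !mcoeffX.
by case: eqP; rewrite ?mulr1 // !mulr0 scale0r.
Qed.

Lemma cl_eval_map_mpoly_algMC p b v :
  cl_eval (map_mpoly (in_alg (clifford R n)) p * b%:MP) v = p.@[v 0] *: b.
Proof.
rewrite /cl_eval map_mpoly_algMC raddf_sum mevalE scaler_suml /=.
apply: eq_bigr => m _; rewrite mevalZ mevalX.
have -> : \prod_i ((v 0 i)%:A : clifford R n) ^+ m i
    = (\prod_i v 0 i ^+ m i)%:A.
  by rewrite -[RHS]/(in_alg _ _) rmorph_prod; apply: eq_bigr => i _;
    rewrite rmorphXn.
by rewrite mulr_algr scalerA mulrC.
Qed.

End ScalarCoefficients.

Section ZonalDecomposition.
Variables (R : realType) (n : nat).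
Implicit Types (v : 'rV[R]_n.+1) (b : nat -> clifford R n).

Lemma para_notin_real v :
  para v \notin 1%VS -> \sum_(i < n) v 0 (lift ord0 i) ^+ 2 != 0.
Proof.
apply: contra => /eqP r0.
rewrite /para big1 => [|i _]; first by rewrite addr0; apply/vlineP; exists (v 0 0).
have /(_ i isT)/eqP := psumr_eq0P (fun i _ => sqr_ge0 (v 0 (lift ord0 i))) r0.
by rewrite sqrf_eq0 => /eqP ->; rewrite scale0r.
Qed.

Lemma clIm_para v :
  clIm (para v) = \sum_(i < n) v 0 (lift ord0 i) *: gen R i.
Proof.
rewrite /clIm clconj_para /para opprB [X in X + _]addrC addrACA subrr addr0.
by rewrite -mulr2n -scaler_nat scalerA mulVf ?scale1r // pnatr_eq0.
Qed.

(** The square of the imaginary part is minus a nonzero sum of squares r, so -r^-1 times the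
    imaginary part inverts it. *)
Lemma clIm_para_unit v : para v \notin 1%VS -> clIm (para v) \is a GRing.unit.
Proof.
move=> /para_notin_real; have := gen_sum_sqr (fun i => v 0 (lift ord0 i)).
rewrite -clIm_para expr2; set r := \sum_(i < n) _ => sq r0.
have rV : (- r^-1) *: (clIm (para v) * clIm (para v)) = 1.
  by rewrite sq scaleNr scalerN opprK scalerA mulVf // scale1r.
apply/unitrP; exists (- r^-1 *: clIm (para v)).
by rewrite -[X in X = _]scalerAl -[in X in _ /\ X]scalerAr.
Qed.

(** x and x^c have the same trace and norm, so their powers expand with the same coefficients: the
    scalar terms cancel in the difference, leaving P_k (x - x^c). Uniqueness then extends the
    equality from nonreal points to the polynomials. *)
Lemma zonal_polyE k : (0 < n)%N -> zonal_poly R n k = (power_rec R n k).1.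
Proof.
move=> n_gt0; apply: (sphder_power_poly_unique n_gt0 (@zonal_polyP R n k)).
move=> v /clIm_para_unit yU.
rewrite /sphder (para_powerE k (or_introl erefl)).
rewrite (para_powerE k (or_intror erefl)) opprB addrA subrK -scalerBr.
have two : 2 != 0 :> R by rewrite pnatr_eq0.
have -> : para v - clconj (para v) = 2 *: clIm (para v).
  by rewrite scalerA divff // scale1r.
move: (clIm _) yU => y yU.
by rewrite -!scalerAr !scalerA mulrCA mulVf // mulr1 mulVr.
Qed.

(** Substitute x = T - x^c in x^(k+1) = P_k x - N P_(k-1) and recognize P_(k+1) = T P_k - N
    P_(k-1). *)
Lemma para_exprS_zonal k v : (0 < n)%N ->
  para v ^+ k.+1 = ((zonal_poly R n k.+1).@[v 0])%:A
    - clconj (para v) * ((zonal_poly R n k).@[v 0])%:A.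
Proof.
move=> n_gt0; rewrite !zonal_polyE // (para_powerE k (or_introl erefl)) /=.
rewrite mevalB (mevalM _ ('X_0 *+ 2)) scalerBl addrAC; congr (_ - _).
rewrite mulrC -scalerA -paraT mulr_algr [in RHS]scalerDr.
by rewrite addrK.
Qed.

Lemma zonal_poly0 : (0 < n)%N -> zonal_poly R n 0 = 1.
Proof. exact: zonal_polyE. Qed.

Lemma para_delta0 : para (delta_mx 0 0 : 'rV[R]_n.+1) = 1.
Proof.
rewrite /para mxE !eqxx scale1r big1 ?addr0 // => i _.
by rewrite mxE eqxx eq_sym (negPf (neq_lift _ _)) scale0r.
Qed.

(** At the pole x = x^c = 1, the power identity becomes 1 = P_(k+1)(1) - P_k(1). *)
Lemma zonal_poly_delta0 k : (0 < n)%N ->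
  (zonal_poly R n k).@[(delta_mx 0 0 : 'rV[R]_n.+1) 0] = k.+1%:R.
Proof.
move=> n_gt0; elim: k => [|k IHk]; first by rewrite zonal_poly0 // meval1.
apply: (fmorph_inj (in_alg (clifford R n))).
have /eqP := para_exprS_zonal k (delta_mx 0 0) n_gt0.
rewrite para_delta0 clconj1 mul1r expr1n IHk eq_sym subr_eq => /eqP /= ->.
by rewrite -[k.+2]add1n natrD scalerDl scale1r.
Qed.

Lemma zonal_poly_neq0 k : (0 < n)%N -> zonal_poly R n k != 0.
Proof.
move=> n_gt0; apply: contra_neq (_ : k.+1%:R != 0 :> R); last by rewrite pnatr_eq0.
by rewrite -zonal_poly_delta0 // => ->; rewrite meval0.
Qed.

Definition zonal_sum b N : {mpoly (clifford R n)[n.+1]} :=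
  \sum_(k < N.+1)
    map_mpoly (in_alg (clifford R n)) (zonal_poly R n k) * (b k)%:MP.

Lemma cl_eval_zonal_sum b N v :
  cl_eval (zonal_sum b N) v = \sum_(k < N.+1) (zonal_poly R n k).@[v 0] *: b k.
Proof.
rewrite /cl_eval raddf_sum; apply: eq_bigr => k _.
exact: cl_eval_map_mpoly_algMC.
Qed.

(** By homogeneity, only the summand of index [mdeg m] can contain the monomial m. *)
Lemma mcoeff_zonal_sum b N m :
  (zonal_sum b N)@_m =
    if (mdeg m <= N)%N then (zonal_poly R n (mdeg m))@_m *: b (mdeg m) else 0.
Proof.
rewrite raddf_sum /=.
have coef0 k : k != mdeg m -> (zonal_poly R n k)@_m = 0.
  by rewrite eq_sym; exact/dhomog_nemf_coeff/zonal_poly_homog.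
case: leqP => [mN|Nm]; last first.
  rewrite big1 // => k _; rewrite mcoeff_map_mpoly_algMC coef0 ?scale0r //.
  by rewrite ltn_eqF // (leq_trans (ltn_ord k)).
rewrite (bigD1 (Ordinal (mN : mdeg m < N.+1)%N)) //= big1 => [|k nk].
  by rewrite addr0 mcoeff_map_mpoly_algMC.
by rewrite mcoeff_map_mpoly_algMC coef0 ?scale0r.
Qed.

Lemma msize_zonal_sum b N : (0 < n)%N -> b N != 0 ->
  msize (zonal_sum b N) = N.+1.
Proof.
move=> n_gt0 bN0; apply/eqP; rewrite eqn_leq; apply/andP; split.
  rewrite msizeE; apply/bigmax_leqP_seq => m + _.
  by rewrite mcoeff_msupp mcoeff_zonal_sum ltnS; case: ifP => //; rewrite eqxx.
(* Lower bound: the leading monomial of P_N has degree N, and its coefficient in the sum is a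
   nonzero real times [b N]. *)
have lead := mlead_supp (zonal_poly_neq0 N n_gt0).
have degN : mdeg (mlead (zonal_poly R n N)) = N.
  exact: dhomog_mf (zonal_poly_homog R n N) _ lead.
rewrite -{1}degN; apply: msize_mdeg_lt.
rewrite mcoeff_msupp mcoeff_zonal_sum degN leqnn scaler_eq0 negb_or bN0 andbT.
by rewrite -mcoeff_msupp.
Qed.

End ZonalDecomposition.

Theorem corollary1 (R : realType) (m n d : nat) (a : 'I_d.+1 -> clifford R n)
    (m_ge1 : (1 <= m)%N) (n_odd : n = (2 * m + 1)%N) (d_ge1 : (1 <= d)%N)
    (ad_neq0 : a ord_max != 0) :
  exists A B : {mpoly (clifford R n)[n.+1]},
    [/\ zonal_mharmonic A, zonal_mharmonic B,
        msize A = d.+1, msize B = (d - 1).+1 &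
        forall v : 'rV[R]_n.+1,
          \sum_(k < d.+1) para v ^+ k * a k =
            cl_eval A v - clconj (para v) * cl_eval B v].
Proof.
have n_gt0 : (0 < n)%N by rewrite n_odd addn1.
case: d d_ge1 a ad_neq0 => // d _ a ad_neq0; rewrite subn1 /=.
(* Here [d] has become [d.+1]. The shift in the second sum reflects that x^(k+1) a_(k+1) contributes
   P_k a_(k+1) to B. *)
pose b k := a (inord k); exists (zonal_sum b d.+1), (zonal_sum (b \o succn) d).
have bd : b d.+1 != 0.
  by rewrite /b (_ : inord _ = ord_max) //; apply/val_inj; rewrite /= inordK.
split; [by exists d.+1, b | by exists d, (b \o succn) | | |move=> v].
- exact: msize_zonal_sum.
- exact: msize_zonal_sum.
rewrite !cl_eval_zonal_sum mulr_sumr big_ord_recl [in RHS]big_ord_recl.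
(* The constant term a_0 = P_0 a_0 belongs to A alone; removing it gives the remaining sums a common
   range. *)
rewrite zonal_poly0 // meval1 scale1r expr0 mul1r -addrA -sumrB.
congr (_ + _); first by congr a; apply/val_inj; rewrite /= inordK.
apply: eq_bigr => k _; rewrite lift0 para_exprS_zonal // mulrBl -mulrA.
have -> : a (lift ord0 k) = b k.+1.
  by congr a; apply/val_inj; rewrite /= inordK // ltnS.
by rewrite !mulr_algl.
Qed.
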